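(* For any $\gamma,\alpha\in(0,1)$, there exists $\delta_{\gamma,\alpha}>0$ such that $\omega^*(\mathrm{CLONE}_{\gamma,\alpha})\le (1-\gamma)+\gamma\,\omega^*(\mathrm{CHSH})-\delta_{\gamma,\alpha}$.
   Context: $\omega^*(G)$ denotes the quantum value (supremum of winning probabilities over quantum strategies) of a game $G$. $\omega^*(\mathrm{CHSH})=\frac12\left(1+\frac1{\sqrt2}\right)$ is the quantum value of the CHSH game (inputs $x,y\in\{0,1\}$ uniform, outputs $a,b\in\{0,1\}$, win iff $a\oplus b=x\cdot y$). The game $\mathrm{CLONE}_{\gamma,\alpha}$ has four players Alice, Barlie, Bob, Charlie. Initially Alice and Barlie share an arbitrary entangled state. Round 1 (no communication): Alice receives uniform $x\in\{0,1\}$; Barlie independently receives $u\in\{0,1,\mathrm{keep}\}$ with $\Pr[u=\mathrm{keep}]=1-\gamma$, $\Pr[u=0]=\Pr[u=1]=\gamma/2$; Alice outputs $a\in\{0,1\}$ and Barlie outputs $s\in\{0,1\}$. Then Barlie applies an arbitrary channel to his registers and distributes the result between Bob and Charlie, who do not communicate afterwards. Round 2: Bob receives $y$ and Charlie receives $z$, where independently $y=\perp$ with probability $\alpha$ and $y=x$ otherwise, and likewise $z=\perp$ with probability $\alpha$ and $z=x$ otherwise; they output $b,c\in\{0,1\}$. The players win iff either ($u\neq\mathrm{keep}$ and $a\oplus s=x\cdot u$) or ($u=\mathrm{keep}$ and ($y=\perp$ or $z=\perp$ or $b=c=a$)). *)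

(* Defs.v *)
From HB Require Import structures.
From mathcomp Require Import all_boot all_order all_algebra.
From mathcomp Require Import complex.
From mathcomp Require Import classical_sets reals.

Set Implicit Arguments.
Unset Strict Implicit.
Unset Printing Implicit Defensive.

Import Order.TTheory GRing.Theory Num.Theory.
Local Open Scope ring_scope.
Local Open Scope classical_set_scope.

Section Quantum.
Variable R : realType.
Local Notation C := R[i].

Definition adjmx m n (M : 'M[C]_(m, n)) : 'M[C]_(n, m) := (map_mx Num.conj M)^T.

Definition psdmx n (M : 'M[C]_n) : Prop :=
  M = adjmx M /\ forall v : 'rV[C]_n, 0 <= (v *m M *m adjmx v) 0 0.

Definition density n (rho : 'M[C]_n) : Prop := psdmx rho /\ \tr rho = 1.

Definition povm (I : finType) n (E : I -> 'M[C]_n) : Prop :=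
  (forall i, psdmx (E i)) /\ \sum_(i : I) E i = 1%:M.

(* Kronecker (tensor) product; the index of 'I_(m*n) is decoded as a pair
   ('I_m * 'I_n) with the library's bijection used by mxvec *)
Definition kidx m n (k : 'I_(m * n)) : 'I_m * 'I_n :=
  enum_val (cast_ord (esym (mxvec_cast m n)) k).

Definition kron m1 n1 m2 n2 (A : 'M[C]_(m1, n1)) (B : 'M[C]_(m2, n2))
  : 'M[C]_(m1 * m2, n1 * n2) :=
  \matrix_(i, j) (A (kidx i).1 (kidx j).1 * B (kidx i).2 (kidx j).2).

(* A quantum instrument from an n-dimensional system to an m-dimensional one,
   with classical outcomes in S, given by Kraus operators K s k
   (CP maps X |-> sum_k K s k X (K s k)^*, summing to a trace-preserving map) *)
Definition instrument (S : finType) m n k (K : S -> 'I_k -> 'M[C]_(m, n)) : Prop :=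
  \sum_(s : S) \sum_(j < k) adjmx (K s j) *m K s j = 1%:M.

Definition apply_instr (S : finType) dA m n k (K : S -> 'I_k -> 'M[C]_(m, n))
  (s : S) (rho : 'M[C]_(dA * n)) : 'M[C]_(dA * m) :=
  \sum_(j < k) (kron 1%:M (K s j) *m rho *m adjmx (kron 1%:M (K s j))).

Record chsh_strategy (dA dB : nat) := ChshStrategy {
  chsh_rho : 'M[C]_(dA * dB);
  chsh_A : bool -> bool -> 'M[C]_dA;   (* input x, output a *)
  chsh_B : bool -> bool -> 'M[C]_dB }. (* input y, output b *)

Definition chsh_valid dA dB (S : chsh_strategy dA dB) : Prop :=
  density (chsh_rho S) /\ (forall x, povm (chsh_A S x)) /\
  (forall y, povm (chsh_B S y)).

Definition chsh_winprob dA dB (S : chsh_strategy dA dB) : R :=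
  \sum_(x : bool) \sum_(y : bool) \sum_(a : bool) \sum_(b : bool)
    (if addb a b == x && y then 4^-1 else 0) *
    complex.Re (\tr (kron (chsh_A S x a) (chsh_B S y b) *m chsh_rho S)).

Definition chsh_qvalue : R :=
  sup [set p | exists (dA dB : nat) (S : chsh_strategy dA dB),
                 chsh_valid S /\ p = chsh_winprob S].

(* Barlie's input u : option bool, with None = keep;
   Bob/Charlie inputs y, z : option bool, with None = bottom. *)

Record clone_strategy (dA dB dBo dCh nK : nat) := CloneStrategy {
  cl_rho : 'M[C]_(dA * dB);                       (* Alice-Barlie state *)
  cl_A : bool -> bool -> 'M[C]_dA;                (* x, a *)
  cl_K : option bool -> bool -> 'I_nK -> 'M[C]_(dBo * dCh, dB);
      (* for input u, Barlie's instrument: outcome s, Kraus index;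
         output space = Bob (x) Charlie *)
  cl_Bob : option bool -> bool -> 'M[C]_dBo;      (* y, b *)
  cl_Charlie : option bool -> bool -> 'M[C]_dCh }. (* z, c *)

Definition clone_valid dA dB dBo dCh nK (S : clone_strategy dA dB dBo dCh nK)
  : Prop :=
  density (cl_rho S) /\ (forall x, povm (cl_A S x)) /\
  (forall u, instrument (cl_K S u)) /\
  (forall y, povm (cl_Bob S y)) /\ (forall z, povm (cl_Charlie S z)).

Definition clone_win (x : bool) (u : option bool) (a s : bool)
  (y z : option bool) (b c : bool) : bool :=
  match u with
  | Some u' => addb a s == x && u'
  | None => [|| y == None, z == None | (b == a) && (c == a)]
  end.

Definition prob_u (g : R) (u : option bool) : R :=
  if u is Some _ then g / 2 else 1 - g.

Definition prob_y (al : R) (x : bool) (y : option bool) : R :=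
  match y with None => al | Some t => if t == x then 1 - al else 0 end.

Definition clone_winprob (g al : R) dA dB dBo dCh nK
  (S : clone_strategy dA dB dBo dCh nK) : R :=
  \sum_(x : bool) \sum_(u : option bool) \sum_(y : option bool)
  \sum_(z : option bool) \sum_(a : bool) \sum_(s : bool) \sum_(b : bool)
  \sum_(c : bool)
    (2^-1 * prob_u g u * prob_y al x y * prob_y al x z) *
    (if clone_win x u a s y z b c then 1 else 0) *
    complex.Re (\tr (kron (cl_A S x a) (kron (cl_Bob S y b) (cl_Charlie S z c))
             *m apply_instr (cl_K S u) s (cl_rho S))).

Definition clone_qvalue (g al : R) : R :=
  sup [set p | exists (dA dB dBo dCh nK : nat)
                 (S : clone_strategy dA dB dBo dCh nK),
                 clone_valid S /\ p = clone_winprob g al S].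

End Quantum.

(* Main.v *)
(* For a state rho, sqn X = Re tr (X rho adj(X)) is the square of a seminorm that does
   not increase under left multiplication by an observable.  Write A_0, A_1 for Alice's
   observables and B_0, B_1 for Barlie's; below, X ~ Y means that sqn (X - Y) is small.
   - If the CHSH rounds are played almost optimally, the sum-of-squares proof of
     Tsirelson's bound gives sqrt 2 B_0 ~ A_0 + A_1 and A_x^2 ~ 1 ~ B_y^2.  Squaring the
     first relation, A_0 and A_1 almost anticommute.
   - If Bob and Charlie, both given x, almost always guess Alice's bit in the keep round,
     then A_0 ~ Bob's observable for x = 0 and A_1 ~ Charlie's for x = 1.  As Bob's and
     Charlie's observables commute, A_0 and A_1 almost commute.
   Since sqn (A_1 A_0) ~ 1, the two cannot hold together: the loss in CHSH plus the error
   in the keep round is bounded below by a constant.  The former lowers the winning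
   probability by a factor gamma, the latter by a factor (1 - gamma) (1 - alpha)^2.
   Finally, Tsirelson's bound is attained in CHSH. *)

Require Import Defs.
From HB Require Import structures.
From mathcomp Require Import all_boot all_order all_algebra.
From mathcomp Require Import complex.
From mathcomp Require Import classical_sets reals.
From mathcomp Require Import ring lra.
Import Order.TTheory GRing.Theory Num.Theory.
Local Open Scope ring_scope.
Local Open Scope complex_scope.

Set Implicit Arguments.
Unset Strict Implicit.
Unset Printing Implicit Defensive.

Lemma sum_mxvec_index (V : nmodType) m n (F : 'I_(m * n) -> V) :
  \sum_k F k = \sum_i \sum_j F (mxvec_index i j).
Proof. by rewrite pair_big (reindex _ (curry_mxvec_bij _ _)); apply: eq_bigr => -[]. Qed.

Lemma sum_option (V : nmodType) (T : finType) (F : option T -> V) :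
  \sum_u F u = F None + \sum_t F (Some t).
Proof.
rewrite (bigD1 None) //=; congr (_ + _).
by rewrite (reindex_omap Some id) => [|[]] //; apply: eq_bigl => t; rewrite eqxx.
Qed.

Lemma scaler_half_double (K : numFieldType) (V : lmodType K) (v : V) :
  2^-1 *: (v + v) = v.
Proof. by rewrite -mulr2n -scalerMnr scalerMnl -mulr_natr mulVf ?scale1r ?pnatr_eq0. Qed.

(* Unlike mxE, leaves matrix products folded. *)
Lemma mx_linE (S : pzRingType) m n :
  (forall (A B : 'M[S]_(m, n)) i j, (A + B) i j = A i j + B i j) *
  (forall (A : 'M[S]_(m, n)) i j, (- A) i j = - A i j) *
  (forall c (A : 'M[S]_(m, n)) i j, (c *: A) i j = c * A i j).
Proof. by do !split; move=> *; rewrite mxE. Qed.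

(* Since sup set0 = 0, nonemptiness of A can be traded for 0 <= x. *)
Lemma sup_le_nneg (R : realType) (A : set R) (x : R) :
  0 <= x -> ubound A x -> sup A <= x.
Proof.
move=> x_ge0 Ax.
by have [->|/set0P/ge_sup] := eqVneq A set0; [rewrite sup0 | apply].
Qed.

Section Kronecker.
Variable R : realType.
Local Notation C := R[i].

Lemma kidx_mxvec_index m n (i : 'I_m) (j : 'I_n) :
  kidx (mxvec_index i j) = (i, j).
Proof. by rewrite /kidx /mxvec_index cast_ordK enum_rankK. Qed.

Lemma eq_mxvec_index m n (i i' : 'I_m) (j j' : 'I_n) :
  (mxvec_index i j == mxvec_index i' j') = (i == i') && (j == j').
Proof.
apply/eqP/andP => [/(congr1 (@kidx m n))|[/eqP-> /eqP->]//].
by rewrite !kidx_mxvec_index => -[-> ->].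
Qed.

Lemma kronE m1 n1 m2 n2 (A : 'M[C]_(m1, n1)) (B : 'M[C]_(m2, n2)) i1 i2 j1 j2 :
  kron A B (mxvec_index i1 i2) (mxvec_index j1 j2) = A i1 j1 * B i2 j2.
Proof. by rewrite mxE !kidx_mxvec_index. Qed.

Lemma mul_kron m1 n1 p1 m2 n2 p2 (A : 'M[C]_(m1, n1)) (B : 'M[C]_(m2, n2))
    (A' : 'M[C]_(n1, p1)) (B' : 'M[C]_(n2, p2)) :
  kron A B *m kron A' B' = kron (A *m A') (B *m B').
Proof.
apply/matrixP => i j.
case/mxvec_indexP: i => i1 i2; case/mxvec_indexP: j => j1 j2.
rewrite kronE !mxE sum_mxvec_index mulr_suml; apply: eq_bigr => k _.
by rewrite mulr_sumr; apply: eq_bigr => l _; rewrite !kronE mulrACA.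
Qed.

Lemma kron1 m n : kron 1%:M 1%:M = 1%:M :> 'M[C]_(m * n).
Proof.
apply/matrixP => i j.
case/mxvec_indexP: i => i1 i2; case/mxvec_indexP: j => j1 j2.
by rewrite kronE !mxE eq_mxvec_index -natrM mulnb.
Qed.

Definition kronr m1 n1 m2 n2 (B : 'M[C]_(m2, n2)) (A : 'M[C]_(m1, n1)) :
  'M[C]_(m1 * m2, n1 * n2) := kron A B.

Fact kron_is_linear m1 n1 m2 n2 (A : 'M[C]_(m1, n1)) :
  linear (kron A : 'M[C]_(m2, n2) -> _).
Proof. by move=> c B B'; apply/matrixP => i j; rewrite !mxE mulrDr mulrCA. Qed.

Fact kronr_is_linear m1 n1 m2 n2 (B : 'M[C]_(m2, n2)) :
  linear (kronr B : 'M[C]_(m1, n1) -> _).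
Proof. by move=> c A A'; apply/matrixP => i j; rewrite !mxE mulrDl mulrA. Qed.

HB.instance Definition _ m1 n1 m2 n2 (A : 'M[C]_(m1, n1)) :=
  GRing.isLinear.Build C 'M[C]_(m2, n2) 'M[C]_(m1 * m2, n1 * n2) *:%R
    (kron A) (@kron_is_linear m1 n1 m2 n2 A).

HB.instance Definition _ m1 n1 m2 n2 (B : 'M[C]_(m2, n2)) :=
  GRing.isLinear.Build C 'M[C]_(m1, n1) 'M[C]_(m1 * m2, n1 * n2) *:%R
    (kronr B) (@kronr_is_linear m1 n1 m2 n2 B).

Lemma kronDl m1 n1 m2 n2 (A A' : 'M[C]_(m1, n1)) (B : 'M[C]_(m2, n2)) :
  kron (A + A') B = kron A B + kron A' B.
Proof. exact: (raddfD (kronr B)). Qed.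

Lemma kronBl m1 n1 m2 n2 (A A' : 'M[C]_(m1, n1)) (B : 'M[C]_(m2, n2)) :
  kron (A - A') B = kron A B - kron A' B.
Proof. exact: (raddfB (kronr B)). Qed.

Lemma kronBr m1 n1 m2 n2 (A : 'M[C]_(m1, n1)) (B B' : 'M[C]_(m2, n2)) :
  kron A (B - B') = kron A B - kron A B'.
Proof. exact: raddfB. Qed.

Lemma kron_suml (I : finType) m1 n1 m2 n2 (A : I -> 'M[C]_(m1, n1)) (B : 'M[C]_(m2, n2)) :
  kron (\sum_i A i) B = \sum_i kron (A i) B.
Proof. exact: (raddf_sum (kronr B)). Qed.

Lemma kron_sumr (I : finType) m1 n1 m2 n2 (A : 'M[C]_(m1, n1)) (B : I -> 'M[C]_(m2, n2)) :
  kron A (\sum_i B i) = \sum_i kron A (B i).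
Proof. exact: raddf_sum. Qed.

Lemma kron_sub1l m n (A : 'M[C]_m) :
  kron (A - 1%:M) 1%:M = kron A 1%:M - 1%:M :> 'M[C]_(m * n).
Proof. by rewrite kronBl kron1. Qed.

Lemma comm_mx_kron m n (A : 'M[C]_m) (B : 'M[C]_n) :
  comm_mx (kron A 1%:M) (kron 1%:M B).
Proof. by rewrite /comm_mx !mul_kron !mulmx1 !mul1mx. Qed.

Lemma mul_mxvec_kron m1 n1 m2 n2 (X : 'M[C]_(m1, m2)) (A : 'M[C]_(m1, n1))
    (B : 'M[C]_(m2, n2)) :
  mxvec X *m kron A B = mxvec (A^T *m X *m B).
Proof.
apply/rowP => k; case/mxvec_indexP: k => i j.
rewrite mxvecE !mxE sum_mxvec_index exchange_big; apply: eq_bigr => l _.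
rewrite !mxE mulr_suml; apply: eq_bigr => k _.
by rewrite mxvecE kronE !mxE mulrA [X k l * _]mulrC.
Qed.

End Kronecker.

Section Adjoint.
Variable R : realType.
Local Notation C := R[i].

Lemma adjmxK m n (M : 'M[C]_(m, n)) : adjmx (adjmx M) = M.
Proof. by apply/matrixP => i j; rewrite !mxE conjCK. Qed.

Lemma adjmxM m n p (M : 'M[C]_(m, n)) (N : 'M[C]_(n, p)) :
  adjmx (M *m N) = adjmx N *m adjmx M.
Proof. by rewrite /adjmx map_mxM trmx_mul. Qed.

Lemma adjmxD m n (M N : 'M[C]_(m, n)) : adjmx (M + N) = adjmx M + adjmx N.
Proof. by rewrite /adjmx map_mxD linearD. Qed.

Lemma adjmxB m n (M N : 'M[C]_(m, n)) : adjmx (M - N) = adjmx M - adjmx N.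
Proof. by rewrite /adjmx map_mxB linearB. Qed.

Lemma adjmxZ m n c (M : 'M[C]_(m, n)) : adjmx (c *: M) = Num.conj c *: adjmx M.
Proof. by rewrite /adjmx map_mxZ linearZ. Qed.

Lemma adjmx1 n : adjmx (1%:M : 'M[C]_n) = 1%:M.
Proof. by rewrite /adjmx map_mx1 trmx1. Qed.

Lemma adjmx_diag n (d : 'rV[C]_n) : adjmx (diag_mx d) = diag_mx (map_mx Num.conj d).
Proof. by rewrite /adjmx map_diag_mx tr_diag_mx. Qed.

Lemma adjmx_kron m1 n1 m2 n2 (A : 'M[C]_(m1, n1)) (B : 'M[C]_(m2, n2)) :
  adjmx (kron A B) = kron (adjmx A) (adjmx B).
Proof. by apply/matrixP => i j; rewrite !mxE rmorphM. Qed.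

Lemma tr_adjmx n (M : 'M[C]_n) : \tr (adjmx M) = Num.conj (\tr M).
Proof. by rewrite /adjmx mxtrace_tr trace_map_mx. Qed.

End Adjoint.

Section PositiveSemidefinite.
Variable R : realType.
Local Notation C := R[i].

Lemma psdmx_conj m n (X : 'M[C]_(n, m)) (M : 'M[C]_n) :
  psdmx M -> psdmx (adjmx X *m M *m X).
Proof.
move=> [adjM M_ge0]; split=> [|v]; first by rewrite !adjmxM adjmxK -adjM mulmxA.
by have := M_ge0 (v *m adjmx X); rewrite adjmxM adjmxK !mulmxA.
Qed.

Lemma psdmx1 n : psdmx (1%:M : 'M[C]_n).
Proof.
split=> [|v]; first by rewrite adjmx1.
by rewrite mulmx1 mxE sumr_ge0 // => i _; rewrite !mxE mul_conjC_ge0.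
Qed.

Lemma psdmx_gram m n (G : 'M[C]_(m, n)) : psdmx (adjmx G *m G).
Proof. by rewrite -[adjmx G]mulmx1; apply/psdmx_conj/psdmx1. Qed.

Lemma psdmx0 n : psdmx (0 : 'M[C]_n).
Proof. by rewrite -(mulmx0 n (adjmx (0 : 'M_n))); apply: psdmx_gram. Qed.

Lemma psdmxD n (M N : 'M[C]_n) : psdmx M -> psdmx N -> psdmx (M + N).
Proof.
move=> [adjM M_ge0] [adjN N_ge0]; split=> [|v]; first by rewrite adjmxD -adjM -adjN.
by rewrite mulmxDr mulmxDl mxE addr_ge0.
Qed.

Lemma psdmxZ n (c : C) (M : 'M[C]_n) : 0 <= c -> psdmx M -> psdmx (c *: M).
Proof.
move=> c_ge0 [adjM M_ge0]; split=> [|v].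
  by rewrite adjmxZ -adjM conj_Creal ?ger0_real.
by rewrite -scalemxAr -scalemxAl mxE mulr_ge0.
Qed.

Lemma psdmx_sum (I : finType) (P : pred I) n (M : I -> 'M[C]_n) :
  (forall i, psdmx (M i)) -> psdmx (\sum_(i | P i) M i).
Proof. by move=> M_psd; apply: big_ind; [apply: psdmx0 | apply: psdmxD | move=> i _]. Qed.

Lemma psdmx_diag_ge0 n (M : 'M[C]_n) i : psdmx M -> 0 <= M i i.
Proof.
move=> [_ /(_ (delta_mx 0 i))].
have -> : adjmx (delta_mx 0 i : 'rV[C]_n) = delta_mx i 0.
  by apply/matrixP => j k; rewrite !mxE rmorph_nat andbC.
by rewrite -rowE -colE !mxE.
Qed.

Lemma psdmx_tr_ge0 n (M : 'M[C]_n) : psdmx M -> 0 <= \tr M.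
Proof. by move=> M_psd; apply: sumr_ge0 => i _; apply: psdmx_diag_ge0. Qed.

Lemma psdmx_factor n (M : 'M[C]_n) :
  psdmx M -> exists G : 'M[C]_n, M = adjmx G *m G.
Proof.
move=> M_psd.
have /hermitian_normalmx/orthomx_spectralP : M \is hermsymmx.
  by apply/is_hermitianmxP; rewrite expr0 scale1r -map_trmx; apply: M_psd.1.
have := spectral_unitarymx M.
move: (spectralmx M) (spectral_diag M) => P d P_unitary M_eq.
have P_inv : invmx P = adjmx P by rewrite invmx_unitary // /adjmx map_trmx.
rewrite P_inv in M_eq.
have PPa : P *m adjmx P = 1%:M by rewrite -P_inv mulmxV // unitarymx_unit.
have diag_eq : diag_mx d = P *m M *m adjmx P.
  by rewrite M_eq !mulmxA PPa mul1mx -mulmxA PPa mulmx1.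
have d_ge0 i : 0 <= d 0 i.
  have /(psdmx_diag_ge0 i) := psdmx_conj (adjmx P) M_psd.
  by rewrite adjmxK -diag_eq mxE eqxx mulr1n.
exists (diag_mx (map_mx sqrtC d) *m P).
rewrite adjmxM mulmxA -[X in X *m P]mulmxA adjmx_diag mulmx_diag M_eq.
congr (_ *m diag_mx _ *m _); apply/rowP => i.
by rewrite !mxE conj_Creal ?ger0_real ?sqrtC_ge0 // -expr2 sqrtCK.
Qed.

Lemma psdmx_kron m n (A : 'M[C]_m) (B : 'M[C]_n) :
  psdmx A -> psdmx B -> psdmx (kron A B).
Proof.
move=> /psdmx_factor[G ->] /psdmx_factor[H ->].
by rewrite -mul_kron -adjmx_kron; apply: psdmx_gram.
Qed.

Lemma psdmx_trM_ge0 n (M N : 'M[C]_n) : psdmx M -> psdmx N -> 0 <= \tr (M *m N).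
Proof.
move=> M_psd /psdmx_factor[G ->].
rewrite mulmxA mxtrace_mulC mulmxA -{1}[G]adjmxK.
exact/psdmx_tr_ge0/psdmx_conj.
Qed.

End PositiveSemidefinite.

Section Measurements.
Variable R : realType.
Local Notation C := R[i].

(* The operators E false - E true of the two-outcome POVMs E are exactly the self-adjoint
   contractions. *)
Definition observable n (Z : 'M[C]_n) : Prop :=
  adjmx Z = Z /\ psdmx (1%:M - Z *m Z).

Lemma observable_kronl m n (Z : 'M[C]_m) :
  observable Z -> observable (kron Z (1%:M : 'M[C]_n)).
Proof.
move=> [adjZ Z_contr]; split; first by rewrite adjmx_kron adjmx1 adjZ.
by rewrite mul_kron mulmx1 -kron1 -kronBl; apply/psdmx_kron/psdmx1.
Qed.

Lemma observable_kronr m n (Z : 'M[C]_n) :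
  observable Z -> observable (kron (1%:M : 'M[C]_m) Z).
Proof.
move=> [adjZ Z_contr]; split; first by rewrite adjmx_kron adjmx1 adjZ.
by rewrite mul_kron mulmx1 -kron1 -kronBr; apply: psdmx_kron => //; apply: psdmx1.
Qed.

Lemma povm_le1 (I : finType) n (E : I -> 'M[C]_n) i :
  povm E -> psdmx (1%:M - E i).
Proof.
by move=> [E_psd <-]; rewrite (bigD1 i) //= addrAC subrr add0r; apply: psdmx_sum.
Qed.

Lemma povm_kronl (I : finType) m n (E : I -> 'M[C]_m) :
  povm E -> povm (fun i => kron (E i) (1%:M : 'M[C]_n)).
Proof.
move=> [E_psd E_sum]; split=> [i|]; first exact/psdmx_kron/psdmx1.
by rewrite -kron_suml E_sum kron1.
Qed.

Lemma povm_kronr (I : finType) m n (E : I -> 'M[C]_n) :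
  povm E -> povm (fun i => kron (1%:M : 'M[C]_m) (E i)).
Proof.
move=> [E_psd E_sum]; split=> [i|]; first exact/psdmx_kron/E_psd/psdmx1.
by rewrite -kron_sumr E_sum kron1.
Qed.

Definition povm_obs n (E : bool -> 'M[C]_n) : 'M[C]_n := E false - E true.

Lemma povm_obs_kronl m n (E : bool -> 'M[C]_m) :
  povm_obs (fun b => kron (E b) (1%:M : 'M[C]_n)) = kron (povm_obs E) 1%:M.
Proof. by rewrite /povm_obs kronBl. Qed.

Lemma povm_obs_kronr m n (E : bool -> 'M[C]_n) :
  povm_obs (fun b => kron (1%:M : 'M[C]_m) (E b)) = kron 1%:M (povm_obs E).
Proof. by rewrite /povm_obs kronBr. Qed.

Lemma povm_obs_observable n (E : bool -> 'M[C]_n) :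
  povm E -> observable (povm_obs E).
Proof.
move=> [E_psd]; rewrite big_bool /= => E_sum.
split; first by rewrite adjmxB -(E_psd false).1 -(E_psd true).1.
rewrite /povm_obs; move: (E false) (E true) (E_psd false) (E_psd true) E_sum.
move=> F G F_psd G_psd FG; have {FG} eG : G = 1%:M - F by rewrite -FG addrK.
suff -> : 1%:M - (F - G) *m (F - G) = 4 *: (F *m G *m F + G *m F *m G).
  apply: psdmxZ; first by rewrite ler0n.
  apply: psdmxD.
    by rewrite {1}F_psd.1; apply: psdmx_conj.
  by rewrite {1}G_psd.1; apply: psdmx_conj.
rewrite eG !(mulmxBl, mulmxBr, mulmx1, mul1mx, mulmxA).
by apply/matrixP => i j; rewrite !mx_linE; ring.
Qed.

Definition involution_povm n (Z : 'M[C]_n) (b : bool) : 'M[C]_n :=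
  2^-1 *: (1%:M + (-1) ^+ b *: Z).

Lemma involution_povmP n (Z : 'M[C]_n) :
  adjmx Z = Z -> Z *m Z = 1%:M -> povm (involution_povm Z).
Proof.
move=> adjZ ZZ; split=> [b|]; last first.
  rewrite big_bool /= /involution_povm expr0 expr1 -scalerDr addrACA -scalerDl.
  by rewrite addNr scale0r addr0 scaler_half_double.
set P := 1%:M + (-1) ^+ b *: Z.
have -> : involution_povm Z b = (2^-1 * 2^-1) *: (adjmx P *m P).
  rewrite /P adjmxD adjmx1 adjmxZ adjZ conj_Creal ?rpredX ?rpredN ?rpred1 //.
  rewrite !(mulmxDl, mulmxDr, mulmx1, mul1mx) -scalemxAl -scalemxAr ZZ.
  rewrite signrZK [X in _ + X]addrC -[RHS]scalerA.
  by rewrite scaler_half_double.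
by apply: psdmxZ; [rewrite mulr_ge0 ?invr_ge0 | apply: psdmx_gram].
Qed.

Lemma involution_povm_obs n (Z : 'M[C]_n) : povm_obs (involution_povm Z) = Z.
Proof.
rewrite /povm_obs -scalerBr opprD addrACA subrr add0r expr0 expr1 scale1r scaleN1r.
by rewrite opprK scaler_half_double.
Qed.

End Measurements.

(* expectation and state_dot are locked so that ring and lra treat them as atoms. *)
HB.lock Definition expectation (R : realType) n (rho M : 'M[R[i]]_n) : R :=
  complex.Re (\tr (M *m rho)).

Section Expectation.
Variables (R : realType) (n : nat) (rho : 'M[R[i]]_n).
Implicit Types M N : 'M[R[i]]_n.

Lemma expectationE M : expectation rho M = complex.Re (\tr (M *m rho)).
Proof. by rewrite expectation.unlock. Qed.

Lemma expectationC M : expectation rho M = expectation M rho.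
Proof. by rewrite !expectation.unlock mxtrace_mulC. Qed.

Fact expectation_is_zmod_morphism : zmod_morphism (expectation rho).
Proof.
move=> M N; rewrite !expectationE mulmxBl linearB.
exact: (raddfB (@complex.Re R : Rcomplex R -> R)).
Qed.

HB.instance Definition _ :=
  GRing.isZmodMorphism.Build _ _ (expectation rho) expectation_is_zmod_morphism.

Lemma expectation_sum (I : finType) (M : I -> 'M[R[i]]_n) :
  expectation rho (\sum_i M i) = \sum_i expectation rho (M i).
Proof. exact: raddf_sum. Qed.

Lemma expectationZ r M : expectation rho (r%:C *: M) = r * expectation rho M.
Proof.
rewrite !expectationE -scalemxAl mxtraceZ.
by case: (\tr _) => a b /=; rewrite mul0r subr0.
Qed.

Lemma expectation_ge0 M : psdmx rho -> psdmx M -> 0 <= expectation rho M.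
Proof.
move=> rho_psd M_psd; rewrite expectationE.
by have := psdmx_trM_ge0 M_psd rho_psd; rewrite lecE => /andP[].
Qed.

Lemma expectation1 : density rho -> expectation rho 1%:M = 1.
Proof. by move=> [_ tr_rho]; rewrite expectationE mul1mx tr_rho. Qed.

Lemma expectation_adjmx M :
  psdmx rho -> expectation rho (adjmx M) = expectation rho M.
Proof.
move=> [adj_rho _]; rewrite !expectationE mxtrace_mulC {1}adj_rho -adjmxM tr_adjmx.
by case: (\tr _).
Qed.

End Expectation.

Lemma sqr_residualE (K : comPzRingType) n (c : K) (B S : 'M[K]_n) : comm_mx B S ->
  S *m S = (c * c) *: (B *m B) - c *: (B *m (c *: B - S)) - S *m (c *: B - S).
Proof. by move=> BS; rewrite !mulmxBr scalerBr -!scalemxAr scalerA BS !subKr. Qed.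

HB.lock Definition state_dot (R : realType) n (rho X Y : 'M[R[i]]_n) : R :=
  expectation rho (adjmx Y *m X).

Definition state_sqn (R : realType) n (rho X : 'M[R[i]]_n) : R := state_dot rho X X.

Section StateSeminorm.
Variables (R : realType) (n : nat) (rho : 'M[R[i]]_n).
Implicit Types X Y Z : 'M[R[i]]_n.

Local Notation sdot := (state_dot rho).
Local Notation sqn := (state_sqn rho).

Lemma sdotE X Y : sdot X Y = expectation rho (adjmx Y *m X).
Proof. by rewrite state_dot.unlock. Qed.

Lemma sdotDl X X' Y : sdot (X + X') Y = sdot X Y + sdot X' Y.
Proof. by rewrite !sdotE mulmxDr raddfD. Qed.

Lemma sdotNl X Y : sdot (- X) Y = - sdot X Y.
Proof. by rewrite !sdotE mulmxN raddfN. Qed.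

Lemma sdotZl r X Y : sdot (r%:C *: X) Y = r * sdot X Y.
Proof. by rewrite !sdotE -scalemxAr expectationZ. Qed.

Lemma sdot_adjmx Z X Y : sdot (Z *m X) Y = sdot X (adjmx Z *m Y).
Proof. by rewrite !sdotE adjmxM adjmxK mulmxA. Qed.

Hypothesis rho_psd : psdmx rho.

Lemma sdotC X Y : sdot X Y = sdot Y X.
Proof. by rewrite !sdotE -expectation_adjmx // adjmxM adjmxK. Qed.

Lemma sdotDr X Y Y' : sdot X (Y + Y') = sdot X Y + sdot X Y'.
Proof. by rewrite sdotC sdotDl !(sdotC _ X). Qed.

Lemma sdotNr X Y : sdot X (- Y) = - sdot X Y.
Proof. by rewrite sdotC sdotNl sdotC. Qed.

Lemma sdotZr r X Y : sdot X (r%:C *: Y) = r * sdot X Y.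
Proof. by rewrite sdotC sdotZl sdotC. Qed.

Lemma sqn_ge0 X : 0 <= sqn X.
Proof. by rewrite /state_sqn sdotE; exact: expectation_ge0 rho_psd (psdmx_gram X). Qed.

Lemma sqnN X : sqn (- X) = sqn X.
Proof. by rewrite /state_sqn sdotNl sdotNr opprK. Qed.

Lemma sqnZ r X : sqn (r%:C *: X) = r ^+ 2 * sqn X.
Proof. by rewrite /state_sqn sdotZl sdotZr mulrA. Qed.

Lemma sqnD X Y : sqn (X + Y) = sqn X + 2 * sdot X Y + sqn Y.
Proof. by rewrite /state_sqn sdotDl !sdotDr (sdotC Y X); ring. Qed.

Lemma sqnB X Y : sqn (X - Y) = sqn X - 2 * sdot X Y + sqn Y.
Proof. by rewrite sqnD sqnN sdotNr mulrN. Qed.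

Lemma sqnD_le X Y : sqn (X + Y) <= 2 * sqn X + 2 * sqn Y.
Proof. by have := sqn_ge0 (X - Y); rewrite sqnB sqnD; lra. Qed.

Lemma sqnB_le X Y : sqn (X - Y) <= 2 * sqn X + 2 * sqn Y.
Proof. by rewrite -(sqnN Y) sqnD_le. Qed.

(* Right multiplication need not contract, as rho stands to the right of X in
   sqn X = Re tr (X rho adj(X)). *)
Lemma sqn_observableM Z X : observable Z -> sqn (Z *m X) <= sqn X.
Proof.
move=> [adjZ Z_contr]; rewrite -subr_ge0 /state_sqn sdot_adjmx adjZ.
rewrite !sdotE adjmxM -raddfB /= adjmxM adjZ.
have -> : adjmx X *m X - adjmx X *m Z *m Z *m X = adjmx X *m (1%:M - Z *m Z) *m X.
  by rewrite mulmxBr mulmxBl mulmx1 !mulmxA.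
exact: expectation_ge0 rho_psd (psdmx_conj X Z_contr).
Qed.

Hypothesis tr_rho : \tr rho = 1.

Lemma sqn1 : sqn 1%:M = 1.
Proof. by rewrite /state_sqn sdotE adjmx1 mulmx1 expectation1. Qed.

Lemma sqn_observable_le1 Z : observable Z -> sqn Z <= 1.
Proof. by move=> /(@sqn_observableM Z 1%:M); rewrite mulmx1 sqn1. Qed.

Lemma sqn_sqr_sub1_le Z : observable Z -> sqn (Z *m Z - 1%:M) <= 1 - sqn Z.
Proof.
move=> Z_obs; have := sqn_observableM Z Z_obs.
by rewrite sqnB sqn1 sdot_adjmx Z_obs.1 mulmx1 /state_sqn; lra.
Qed.

Lemma sqn_observable_sub_le X Y k :
  observable X -> observable Y -> 1 - k <= sdot X Y -> sqn (X - Y) <= 2 * k.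
Proof.
move=> /sqn_observable_le1 + /sqn_observable_le1.
by rewrite sqnB; lra.
Qed.

Definition chsh_form (A B : bool -> 'M[R[i]]_n) : R :=
  \sum_x \sum_y (-1) ^+ (x && y) * sdot (A x) (B y).

(* Nonnegative exactly when chsh_form A B satisfies Tsirelson's bound 2 sqrt 2; scaled so
   that the sum of squares in chsh_sos adds up to twice its value. *)
Definition chsh_defect A B : R := 4 - Num.sqrt 2 * chsh_form A B.

Definition chsh_residual (A B : bool -> 'M[R[i]]_n) (y : bool) : 'M[R[i]]_n :=
  (Num.sqrt 2)%:C *: B y - (A false + (-1) ^+ y *: A true).

Lemma chsh_sos A B :
  \sum_y sqn (chsh_residual A B y) +
    2 * (\sum_x (1 - sqn (A x)) + \sum_y (1 - sqn (B y))) = 2 * chsh_defect A B.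
Proof.
rewrite !big_bool /= /chsh_residual expr0 expr1 scale1r scaleN1r.
rewrite /chsh_defect /chsh_form !big_bool /= expr0 expr1.
rewrite !sqnB !sqnD !sqnZ sqr_sqrtr // !sdotZl !sdotDr sdotNr !(sdotC (B _)).
by ring.
Qed.

Section Rigidity.
Variables A B : bool -> 'M[R[i]]_n.
Hypotheses (A_obs : forall x, observable (A x)) (B_obs : forall y, observable (B y)).

Local Notation defect := (chsh_defect A B).

Lemma chsh_sos_bounds :
  [/\ forall y, sqn (chsh_residual A B y) <= 2 * defect,
      forall x, 1 - sqn (A x) <= defect & forall y, 1 - sqn (B y) <= defect].
Proof.
have := chsh_sos A B; rewrite !big_bool /=.
move: defect (chsh_residual A B) => d D sos.
have D_ge0 y := sqn_ge0 (D y).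
have A_le1 x := sqn_observable_le1 (A_obs x).
have B_le1 y := sqn_observable_le1 (B_obs y).
have := (D_ge0 false, D_ge0 true, A_le1 false, A_le1 true, B_le1 false, B_le1 true).
by move=> [[[[[D0 D1] A0] A1] B0] B1]; split=> -[]; lra.
Qed.

Lemma chsh_defect_ge0 : 0 <= defect.
Proof.
by have [_ /(_ true) + _] := chsh_sos_bounds; have := sqn_observable_le1 (A_obs true); lra.
Qed.

Lemma sqn_sqr_sub1_chsh x : sqn (A x *m A x - 1%:M) <= defect.
Proof.
by have [_ /(_ x) + _] := chsh_sos_bounds; apply/le_trans/sqn_sqr_sub1_le.
Qed.

Lemma anticommutator_chsh_residual (D := chsh_residual A B false) :
    (forall x, comm_mx (B false) (A x)) ->
  A false *m A true + A true *m A false =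
    (2%:C *: (B false *m B false - 1%:M) - (Num.sqrt 2)%:C *: (B false *m D)) -
    (A false *m D + A true *m D) -
    ((A false *m A false - 1%:M) + (A true *m A true - 1%:M)).
Proof.
move=> BA; have D_eq : D = (Num.sqrt 2)%:C *: B false - (A false + A true).
  by rewrite /D /chsh_residual expr0 scale1r.
move: D D_eq => D D_eq.
have sqrt2_sqr : (Num.sqrt 2)%:C * (Num.sqrt 2)%:C = 2%:C :> R[i].
  by rewrite -rmorphM -expr2 sqr_sqrtr.
have := sqr_residualE (Num.sqrt 2)%:C (comm_mxD (BA false) (BA true)).
rewrite -D_eq sqrt2_sqr !mulmxDl !mulmxDr => AA.
have -> : A false *m A true + A true *m A false =
    A false *m A false + A false *m A true + (A true *m A false + A true *m A true) -
    (A false *m A false + A true *m A true).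
  by rewrite [X in _ + X - _]addrC addrACA [X in X - _]addrC addrK.
rewrite {}AA rmorph_nat.
move: (B false *m B false) (B false *m D) (A false *m D + A true *m D).
move: (A false *m A false) (A true *m A true) => A00 A11 BB BD SD.
by apply/matrixP => i j; rewrite !mx_linE; ring.
Qed.

Lemma sqn_anticommutator_chsh : (forall x, comm_mx (B false) (A x)) ->
  sqn (A false *m A true + A true *m A false) <= 104 * defect.
Proof.
move=> /anticommutator_chsh_residual ->.
have [/(_ false) D_le _ _] := chsh_sos_bounds.
set D := chsh_residual A B false in D_le *.
have B_le : sqn (B false *m B false - 1%:M) <= defect.
  by have [_ _ /(_ false)] := chsh_sos_bounds; apply/le_trans/sqn_sqr_sub1_le.
have BD_le : sqn (2%:C *: (B false *m B false - 1%:M) -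
    (Num.sqrt 2)%:C *: (B false *m D)) <= 16 * defect.
  apply: le_trans (sqnB_le _ _) _; rewrite !sqnZ sqr_sqrtr //.
  by have := sqn_observableM D (B_obs false); lra.
have AD_le : sqn (A false *m D + A true *m D) <= 8 * defect.
  apply: le_trans (sqnD_le _ _) _.
  by have := sqn_observableM D (A_obs false); have := sqn_observableM D (A_obs true); lra.
have AA_le : sqn ((A false *m A false - 1%:M) + (A true *m A true - 1%:M)) <= 4 * defect.
  apply: le_trans (sqnD_le _ _) _.
  by have := sqn_sqr_sub1_chsh false; have := sqn_sqr_sub1_chsh true; lra.
apply: le_trans (sqnB_le _ _) _.
set X := 2%:C *: _ - _ in BD_le *; set Y := A false *m D + _ in AD_le *.
by have := sqnB_le X Y; lra.
Qed.

End Rigidity.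

Section Monogamy.
Variables A0 A1 B C : 'M[R[i]]_n.
Hypotheses (A0_obs : observable A0) (A1_obs : observable A1).
Hypotheses (B_obs : observable B) (C_obs : observable C).

Lemma commutator_approx : comm_mx A0 C -> comm_mx A1 B -> comm_mx B C ->
  A0 *m A1 - A1 *m A0 =
    (A0 *m (A1 - C) - B *m (A1 - C)) + (C *m (A0 - B) - A1 *m (A0 - B)).
Proof.
move=> A0C A1B BC; rewrite !mulmxBr A0C A1B BC.
by apply/matrixP => i j; rewrite !mx_linE; ring.
Qed.

Lemma sqn_commutator_le e :
  comm_mx A0 C -> comm_mx A1 B -> comm_mx B C ->
  sqn (A0 - B) <= e -> sqn (A1 - C) <= e -> sqn (A0 *m A1 - A1 *m A0) <= 16 * e.
Proof.
move=> A0C A1B BC U_le V_le; rewrite commutator_approx //.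
set U := A0 - B in U_le *; set V := A1 - C in V_le *.
have V_term : sqn (A0 *m V - B *m V) <= 4 * e.
  apply: le_trans (sqnB_le _ _) _.
  by have := sqn_observableM V A0_obs; have := sqn_observableM V B_obs; lra.
have U_term : sqn (C *m U - A1 *m U) <= 4 * e.
  apply: le_trans (sqnB_le _ _) _.
  by have := sqn_observableM U C_obs; have := sqn_observableM U A1_obs; lra.
by apply: le_trans (sqnD_le _ _) _; lra.
Qed.

(* A1 need not contract from the right, so A1^2 - 1 is first moved past B. *)
Lemma sqn_mul_ge k : comm_mx A1 B -> 1 - k <= sdot A0 B ->
  1 <= 2 * sqn (A1 *m A0) + 4 * sqn (A1 *m A1 - 1%:M) + 10 * k.
Proof.
move=> A1B AB_ge.
have U_le := sqn_observable_sub_le A0_obs B_obs AB_ge; set U := A0 - B in U_le.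
have B_eq : B = A1 *m (A1 *m A0) - (B *m (A1 *m A1 - 1%:M) + A1 *m (A1 *m U)).
  have A1A1B : A1 *m (A1 *m B) = B *m (A1 *m A1) by rewrite A1B mulmxA A1B mulmxA.
  rewrite /U !mulmxBr mulmx1 A1A1B.
  by apply/matrixP => i j; rewrite !mx_linE; ring.
have B_ge : 1 - 2 * k <= sqn B.
  by have := sqn_ge0 U; have := sqn_observable_le1 A0_obs; rewrite sqnB; lra.
have main_le : sqn (A1 *m (A1 *m A0)) <= sqn (A1 *m A0) by apply: sqn_observableM.
have rest_le : sqn (B *m (A1 *m A1 - 1%:M) + A1 *m (A1 *m U)) <=
    2 * sqn (A1 *m A1 - 1%:M) + 4 * k.
  apply: le_trans (sqnD_le _ _) _.
  have := sqn_observableM (A1 *m A1 - 1%:M) B_obs.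
  by have := sqn_observableM (A1 *m U) A1_obs; have := sqn_observableM U A1_obs; lra.
have := sqnB_le (A1 *m (A1 *m A0)) (B *m (A1 *m A1 - 1%:M) + A1 *m (A1 *m U)).
by rewrite -B_eq; lra.
Qed.

Lemma monogamy k :
  comm_mx A0 C -> comm_mx A1 B -> comm_mx B C ->
  1 - k <= sdot A0 B -> 1 - k <= sdot A1 C ->
  1 <= 4 * sqn (A1 *m A1 - 1%:M) + sqn (A0 *m A1 + A1 *m A0) + 42 * k.
Proof.
move=> A0C A1B BC AB_ge AC_ge.
have K_le := sqn_commutator_le A0C A1B BC
  (sqn_observable_sub_le A0_obs B_obs AB_ge) (sqn_observable_sub_le A1_obs C_obs AC_ge).
have prod_ge := sqn_mul_ge A1B AB_ge.
have := sqnB_le (A0 *m A1 + A1 *m A0) (A0 *m A1 - A1 *m A0).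
have -> : A0 *m A1 + A1 *m A0 - (A0 *m A1 - A1 *m A0) = 2%:C *: (A1 *m A0).
  by rewrite rmorph_nat; apply/matrixP => i j; rewrite !mx_linE; ring.
by rewrite sqnZ; lra.
Qed.

End Monogamy.
End StateSeminorm.

Section Correlations.
Variables (R : realType) (m n : nat) (rho : 'M[R[i]]_(m * n)).
Local Notation C := R[i].

Lemma state_dot_kron (A : 'M[C]_m) (B : 'M[C]_n) : adjmx B = B ->
  state_dot rho (kron A 1%:M) (kron 1%:M B) = expectation rho (kron A B).
Proof. by move=> adjB; rewrite sdotE adjmx_kron adjmx1 adjB mul_kron mulmx1 mul1mx. Qed.

Lemma expectation_kron_suml (I : finType) (E : I -> 'M[C]_m) (B : 'M[C]_n) :
  povm E -> \sum_i expectation rho (kron (E i) B) = expectation rho (kron 1%:M B).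
Proof. by move=> [_ <-]; rewrite kron_suml expectation_sum. Qed.

Lemma expectation_kron_sumr (I : finType) (A : 'M[C]_m) (F : I -> 'M[C]_n) :
  povm F -> \sum_i expectation rho (kron A (F i)) = expectation rho (kron A 1%:M).
Proof. by move=> [_ <-]; rewrite kron_sumr expectation_sum. Qed.

Lemma expectation_xor (E : bool -> 'M[C]_m) (F : bool -> 'M[C]_n) t :
  density rho -> povm E -> povm F ->
  \sum_a expectation rho (kron (E a) (F (a (+) t))) =
    (1 + (-1) ^+ t * expectation rho (kron (povm_obs E) (povm_obs F))) / 2.
Proof.
move=> rho_density E_povm F_povm.
have : \sum_a \sum_b expectation rho (kron (E a) (F b)) = 1.
  under eq_bigr do rewrite expectation_kron_sumr //.
  by rewrite expectation_kron_suml // kron1 expectation1.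
rewrite /povm_obs kronBl !kronBr !raddfB /=.
by rewrite !big_bool; case: t; rewrite /= ?expr0 ?expr1; lra.
Qed.

Hypothesis rho_psd : psdmx rho.

Lemma expectation_kron_ge0 (A : 'M[C]_m) (B : 'M[C]_n) :
  psdmx A -> psdmx B -> 0 <= expectation rho (kron A B).
Proof. by move=> A_psd B_psd; apply/expectation_ge0/psdmx_kron. Qed.

Lemma expectation_kron_le (A : 'M[C]_m) (B B' : 'M[C]_n) :
  psdmx A -> psdmx (B' - B) -> expectation rho (kron A B) <= expectation rho (kron A B').
Proof.
by move=> A_psd BB'; rewrite -subr_ge0 -raddfB -kronBr; apply: expectation_kron_ge0.
Qed.

End Correlations.

Section ChshGame.
Variable R : realType.
Local Notation C := R[i].

Definition tsirelson_value : R := 1 / 2 + Num.sqrt 2 / 4.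

Section Strategy.
Variables (dA dB : nat) (S : chsh_strategy R dA dB).
Hypothesis S_valid : chsh_valid S.

Definition alice_obs (x : bool) : 'M[C]_(dA * dB) :=
  kron (povm_obs (chsh_A S x)) 1%:M.

Definition bob_obs (y : bool) : 'M[C]_(dA * dB) :=
  kron 1%:M (povm_obs (chsh_B S y)).

Lemma alice_obs_observable x : observable (alice_obs x).
Proof. by case: S_valid => _ [A_povm _]; apply/observable_kronl/povm_obs_observable. Qed.

Lemma bob_obs_observable y : observable (bob_obs y).
Proof. by case: S_valid => _ [_ B_povm]; apply/observable_kronr/povm_obs_observable. Qed.

Lemma comm_bob_alice y x : comm_mx (bob_obs y) (alice_obs x).
Proof. exact/comm_mx_sym/comm_mx_kron. Qed.

Definition chsh_score (x y : bool) : R := \sum_a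
  expectation (chsh_rho S) (kron (chsh_A S x a) (chsh_B S y (a (+) (x && y)))).

Lemma chsh_winprob_score : chsh_winprob S = \sum_x \sum_y 4^-1 * chsh_score x y.
Proof.
apply: eq_bigr => x _; apply: eq_bigr => y _.
rewrite mulr_sumr; apply: eq_bigr => a _.
rewrite !big_bool -!expectationE /=.
by case: a (x && y) => -[] /=; rewrite mul0r ?addr0 ?add0r.
Qed.

Lemma chsh_winprobE :
  chsh_winprob S = 1 / 2 + chsh_form (chsh_rho S) alice_obs bob_obs / 8.
Proof.
case: S_valid => rho_density [A_povm B_povm].
have corrE x y : state_dot (chsh_rho S) (alice_obs x) (bob_obs y) =
    expectation (chsh_rho S) (kron (povm_obs (chsh_A S x)) (povm_obs (chsh_B S y))).
  by apply: state_dot_kron; case: (povm_obs_observable (B_povm y)).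
rewrite chsh_winprob_score /chsh_form.
under eq_bigr => x _ do
  under eq_bigr => y _ do rewrite /chsh_score expectation_xor // -corrE.
by rewrite !big_bool /=; lra.
Qed.

Lemma chsh_defectE : chsh_defect (chsh_rho S) alice_obs bob_obs =
  8 * Num.sqrt 2 * (tsirelson_value - chsh_winprob S).
Proof.
rewrite chsh_winprobE /chsh_defect /tsirelson_value.
have := sqr_sqrtr (ler0n R 2); move: (Num.sqrt 2) (chsh_form _ _ _) => r f r2.
by transitivity (2 * r ^+ 2 - r * f); [rewrite r2; ring | field].
Qed.

Lemma tsirelson_bound : chsh_winprob S <= tsirelson_value.
Proof.
case: (S_valid) => -[rho_psd tr_rho] _.
have := chsh_defect_ge0 rho_psd tr_rho alice_obs_observable bob_obs_observable.
by rewrite chsh_defectE pmulr_rge0 ?subr_ge0 // mulr_gt0 ?sqrtr_gt0.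
Qed.

End Strategy.

Definition max_entangled d : 'M[C]_(d * d) :=
  d%:R^-1 *: (adjmx (mxvec 1%:M) *m mxvec 1%:M).

Lemma tr_kron_max_entangled d (A B : 'M[C]_d) :
  \tr (kron A B *m max_entangled d) = d%:R^-1 * \tr (A^T *m B).
Proof.
rewrite /max_entangled -scalemxAr mxtraceZ mulmxA mxtrace_mulC mulmxA.
rewrite mul_mxvec_kron mulmx1; congr (_ * _).
have vec1E i j : adjmx (mxvec (1%:M : 'M[C]_d)) (mxvec_index i j) 0 = (i == j)%:R.
  by rewrite !mxE mxvecE mxE rmorph_nat.
rewrite /mxtrace big_ord1 mxE sum_mxvec_index; apply: eq_bigr => i _.
rewrite (bigD1 i) //= big1 => [|j /negbTE ji]; rewrite vec1E.
  by rewrite mxvecE eqxx mulr1 addr0.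
by rewrite eq_sym ji mulr0.
Qed.

Lemma max_entangled_density d : (0 < d)%N -> density (max_entangled d).
Proof.
move=> d_gt0; split; first by apply: psdmxZ; [rewrite invr_ge0 ler0n | apply: psdmx_gram].
rewrite -[max_entangled d]mul1mx -kron1 tr_kron_max_entangled.
by rewrite trmx1 mulmx1 mxtrace1 mulVf // pnatr_eq0 -lt0n.
Qed.

Definition reflection (c s : R) : 'M[C]_2 :=
  \matrix_(i, j) (if i == j then if i == 0 then c else - c else s)%:C.

Lemma tr_mul_reflection c s c' s' :
  \tr (reflection c s *m reflection c' s') = (2 * (c * c' + s * s'))%:C.
Proof.
rewrite /mxtrace !big_ord_recl big_ord0 !mxE !big_ord_recl !big_ord0 !mxE /=.
by rewrite !addr0 -!rmorphM -!rmorphD /=; congr (_%:C); ring.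
Qed.

Lemma trmx_reflection c s : (reflection c s)^T = reflection c s.
Proof. by apply/matrixP => i j; rewrite !mxE eq_sym; case: eqP => // ->. Qed.

Lemma adjmx_reflection c s : adjmx (reflection c s) = reflection c s.
Proof.
rewrite -[RHS]trmx_reflection /adjmx; congr (_ ^T); apply/matrixP => i j.
by rewrite !mxE conj_Creal // complex_real.
Qed.

Lemma reflection_sqr c s : c ^+ 2 + s ^+ 2 = 1 ->
  reflection c s *m reflection c s = 1%:M.
Proof.
move=> cs1; apply/matrixP => -[[|[|i]] hi] [[|[|j]] hj] //;
  rewrite !mxE !big_ord_recl big_ord0 !mxE /= addr0 -!rmorphM -rmorphD;
  by rewrite -[RHS](rmorph_nat (real_complex R)); congr (_%:C); rewrite /=; lra.
Qed.

Lemma expectation_reflection c s c' s' :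
  expectation (max_entangled 2) (kron (reflection c s) (reflection c' s')) =
    c * c' + s * s'.
Proof.
rewrite expectationE tr_kron_max_entangled trmx_reflection tr_mul_reflection.
by rewrite rmorphM rmorph_nat mulKf // pnatr_eq0.
Qed.

Definition chsh_optimal : chsh_strategy R 2 2 :=
  ChshStrategy (max_entangled 2)
    (fun x => involution_povm (if x then reflection 0 1 else reflection 1 0))
    (fun y => let r := Num.sqrt 2 / 2 in
      involution_povm (reflection r (if y then - r else r))).

Lemma chsh_optimal_valid : chsh_valid chsh_optimal.
Proof.
have reflectionP c s : c ^+ 2 + s ^+ 2 = 1 -> povm (involution_povm (reflection c s)).
  by move=> cs1; apply: involution_povmP; [apply: adjmx_reflection | apply: reflection_sqr].
split; first exact: max_entangled_density.
by split=> -[] /=; apply: reflectionP; rewrite ?sqrrN ?expr_div_n ?sqr_sqrtr //; field.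
Qed.

Lemma chsh_optimal_winprob : chsh_winprob chsh_optimal = tsirelson_value.
Proof.
have corrE x y : state_dot (max_entangled 2) (alice_obs chsh_optimal x)
    (bob_obs chsh_optimal y) = (-1) ^+ (x && y) * (Num.sqrt 2 / 2).
  rewrite state_dot_kron !involution_povm_obs ?adjmx_reflection //.
  by case: x y => -[] /=; rewrite expectation_reflection ?expr0 ?expr1; ring.
rewrite (chsh_winprobE chsh_optimal_valid) /chsh_form /tsirelson_value.
under eq_bigr => x _ do under eq_bigr => y _ do rewrite corrE signrMK.
by rewrite !big_bool /=; field.
Qed.

Lemma chsh_qvalueE : chsh_qvalue R = tsirelson_value.
Proof.
rewrite /chsh_qvalue; set values := (X in sup X).
have values_ub : ubound values tsirelson_value.
  by move=> _ [dA [dB [S [S_valid ->]]]]; apply: tsirelson_bound.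
have value_attained : values tsirelson_value.
  exists 2, 2, chsh_optimal.
  by split; [apply: chsh_optimal_valid | rewrite chsh_optimal_winprob].
apply/le_anti/andP; split; first by apply: ge_sup => //; exists tsirelson_value.
by apply: ub_le_sup => //; exists tsirelson_value.
Qed.

End ChshGame.

Section Instruments.
Variables (R : realType) (T : finType) (m n k : nat).
Local Notation C := R[i].
Variable K : T -> 'I_k -> 'M[C]_(m, n).

Definition instr_dual (s : T) (M : 'M[C]_m) : 'M[C]_n :=
  \sum_(j < k) adjmx (K s j) *m M *m K s j.

Lemma tr_apply_instr d s (rho : 'M[C]_(d * n)) (A : 'M[C]_d) (M : 'M[C]_m) :
  \tr (kron A M *m apply_instr K s rho) = \tr (kron A (instr_dual s M) *m rho).
Proof.
rewrite /apply_instr mulmx_sumr kron_sumr mulmx_suml !linear_sum /=.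
apply: eq_bigr => j _; rewrite !mulmxA mxtrace_mulC !mulmxA.
by rewrite adjmx_kron adjmx1 !mul_kron mulmx1 mul1mx.
Qed.

Lemma psdmx_apply_instr d s (rho : 'M[C]_(d * n)) :
  psdmx rho -> psdmx (apply_instr K s rho).
Proof.
move=> rho_psd; apply: psdmx_sum => j.
by rewrite -{1}[kron _ _]adjmxK; apply: psdmx_conj.
Qed.

Hypothesis K_instr : instrument K.

Lemma instr_dual_povm : povm (fun s => instr_dual s 1%:M).
Proof.
split=> [s|]; first by apply: psdmx_sum => j; apply/psdmx_conj/psdmx1.
by rewrite -K_instr; apply: eq_bigr => s _; apply: eq_bigr => j _; rewrite mulmx1.
Qed.

Lemma tr_sum_apply_instr d (rho : 'M[C]_(d * n)) (A : 'M[C]_d) :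
  \tr (kron A 1%:M *m \sum_s apply_instr K s rho) = \tr (kron A 1%:M *m rho).
Proof.
rewrite mulmx_sumr linear_sum /=.
under eq_bigr do rewrite tr_apply_instr.
by rewrite -linear_sum -mulmx_suml -kron_sumr instr_dual_povm.2.
Qed.

Lemma density_sum_apply_instr d (rho : 'M[C]_(d * n)) :
  density rho -> density (\sum_s apply_instr K s rho).
Proof.
move=> [rho_psd tr_rho]; split; first by apply: psdmx_sum => s; apply: psdmx_apply_instr.
by have := tr_sum_apply_instr rho 1%:M; rewrite !kron1 !mul1mx tr_rho.
Qed.

End Instruments.

Section CloneGame.
Variable R : realType.
Local Notation C := R[i].

Lemma sum_prob_y (al : R) x (F : option bool -> R) :
  \sum_y prob_y al x y * F y = al * F None + (1 - al) * F (Some x).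
Proof. by rewrite sum_option big_bool; case: x => /=; ring. Qed.

Lemma sum_prob_u (g : R) (F : option bool -> R) :
  \sum_u prob_u g u * F u = (1 - g) * F None + g / 2 * \sum_u F (Some u).
Proof. by rewrite sum_option mulr_sumr. Qed.

Variables (dA dB dBo dCh nK : nat) (S : clone_strategy R dA dB dBo dCh nK).

(* Unless u = keep, Bob and Charlie are ignored and Barlie's instrument reduces to the
   measurement of its outcome. *)
Definition chsh_of_clone : chsh_strategy R dA dB :=
  ChshStrategy (cl_rho S) (cl_A S) (fun u s => instr_dual (cl_K S (Some u)) s 1%:M).

Definition keep_state : 'M[C]_(dA * (dBo * dCh)) :=
  \sum_s apply_instr (cl_K S None) s (cl_rho S).

Definition guess_success (x : bool) : R := \sum_a expectation keep_state
  (kron (cl_A S x a) (kron (cl_Bob S (Some x) a) (cl_Charlie S (Some x) a))).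

Definition keep_error : R := (\sum_x (1 - guess_success x)) / 2.

Definition clone_score (x : bool) (u y z : option bool) : R :=
  \sum_a \sum_s \sum_b \sum_c (if clone_win x u a s y z b c then 1 else 0) *
    expectation (apply_instr (cl_K S u) s (cl_rho S))
      (kron (cl_A S x a) (kron (cl_Bob S y b) (cl_Charlie S z c))).

Lemma clone_winprob_score g al : clone_winprob g al S =
  \sum_x 2^-1 * \sum_u prob_u g u * \sum_y prob_y al x y *
    \sum_z prob_y al x z * clone_score x u y z.
Proof.
apply: eq_bigr => x _; rewrite mulr_sumr; apply: eq_bigr => u _.
rewrite !mulr_sumr; apply: eq_bigr => y _.
rewrite !mulr_sumr; apply: eq_bigr => z _; rewrite !mulrA.
rewrite mulr_sumr; apply: eq_bigr => a _; rewrite mulr_sumr; apply: eq_bigr => s _.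
rewrite mulr_sumr; apply: eq_bigr => b _; rewrite mulr_sumr; apply: eq_bigr => c _.
by rewrite expectationE mulrA.
Qed.

Hypothesis S_valid : clone_valid S.

Lemma chsh_of_clone_valid : chsh_valid chsh_of_clone.
Proof.
case: S_valid => rho_density [A_povm [K_instr _]].
by split=> //; split=> // u; apply: instr_dual_povm.
Qed.

Lemma keep_state_density : density keep_state.
Proof. by case: S_valid => ? [_ [K_instr _]]; apply: density_sum_apply_instr. Qed.

Lemma state_sqn_keep (X : 'M[C]_dA) :
  state_sqn keep_state (kron X 1%:M) = state_sqn (cl_rho S) (kron X 1%:M).
Proof.
case: S_valid => _ [_ [K_instr _]].
rewrite /state_sqn !sdotE !adjmx_kron !adjmx1 !mul_kron !mulmx1 !expectationE.
by rewrite tr_sum_apply_instr.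
Qed.

Lemma clone_score_chsh x u y z :
  clone_score x (Some u) y z = chsh_score chsh_of_clone x u.
Proof.
case: S_valid => _ [_ [_ [Bob_povm Charlie_povm]]].
apply: eq_bigr => a _; rewrite (bigD1 (a (+) (x && u))) //= addKb eqxx.
rewrite [X in _ + X]big1 => [|s s_neq]; last first.
  have -> : (addb a s == x && u) = false by case: a s (x && u) s_neq => -[] [].
  by rewrite big1 // => b _; rewrite big1 // => c _; rewrite mul0r.
rewrite addr0.
under eq_bigr do under eq_bigr do rewrite mul1r.
under eq_bigr do rewrite -expectation_sum -!kron_sumr (Charlie_povm z).2.
rewrite -expectation_sum -kron_sumr -kron_suml (Bob_povm y).2 kron1.
by rewrite !expectationE tr_apply_instr.
Qed.

Lemma clone_score_keep x y z : clone_score x None y z =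
  \sum_a \sum_b \sum_c (if clone_win x None a false y z b c then 1 else 0) *
    expectation keep_state (kron (cl_A S x a) (kron (cl_Bob S y b) (cl_Charlie S z c))).
Proof.
apply: eq_bigr => a _; rewrite exchange_big; apply: eq_bigr => b _ /=.
rewrite exchange_big; apply: eq_bigr => c _ /=.
rewrite -mulr_sumr expectationC expectation_sum.
by under [in RHS]eq_bigr do rewrite expectationC.
Qed.

Lemma clone_score_keep_bot x y z : (y == None) || (z == None) ->
  clone_score x None y z = 1.
Proof.
case: S_valid => _ [A_povm [_ [Bob_povm Charlie_povm]]] yz.
have win a b c : clone_win x None a false y z b c by rewrite /= orbA yz.
rewrite clone_score_keep.
under eq_bigr do under eq_bigr do under eq_bigr do rewrite win mul1r.
under eq_bigr do under eq_bigr do rewrite -expectation_sum -!kron_sumr (Charlie_povm z).2.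
under eq_bigr do rewrite -expectation_sum -kron_sumr -kron_suml (Bob_povm y).2 kron1.
by rewrite expectation_kron_suml // kron1 expectation1 //; apply: keep_state_density.
Qed.

Lemma clone_score_keep_guess x : clone_score x None (Some x) (Some x) = guess_success x.
Proof.
rewrite clone_score_keep; apply: eq_bigr => a _.
by rewrite !big_bool; case: a => /=; ring.
Qed.

Lemma clone_winprobE g al : clone_winprob g al S =
  g * chsh_winprob chsh_of_clone + (1 - g) * (1 - (1 - al) ^+ 2 * keep_error).
Proof.
rewrite clone_winprob_score chsh_winprob_score /keep_error.
under eq_bigr => x _.
  rewrite sum_prob_u !sum_prob_y clone_score_keep_guess !clone_score_keep_bot //.
  under eq_bigr => u _ do rewrite !sum_prob_y !clone_score_chsh.
  over.
rewrite !big_bool /=; move: guess_success (chsh_score _) => p q.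
by field.
Qed.

Lemma guess_success_le (F : bool -> 'M[C]_(dBo * dCh)) x :
  (forall a, psdmx (F a - kron (cl_Bob S (Some x) a) (cl_Charlie S (Some x) a))) ->
  guess_success x <= \sum_a expectation keep_state (kron (cl_A S x a) (F a)).
Proof.
case: S_valid => _ [A_povm _] F_ge; apply: ler_sum => a _.
by apply: expectation_kron_le (F_ge a); [case: keep_state_density | case: (A_povm x)].
Qed.

Lemma guess_success_le_corr (F : bool -> 'M[C]_(dBo * dCh)) x : povm F ->
  (forall a, psdmx (F a - kron (cl_Bob S (Some x) a) (cl_Charlie S (Some x) a))) ->
  2 * guess_success x - 1 <=
    state_dot keep_state (kron (povm_obs (cl_A S x)) 1%:M) (kron 1%:M (povm_obs F)).
Proof.
case: S_valid => _ [A_povm _] F_povm /guess_success_le.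
have := expectation_xor false keep_state_density (A_povm x) F_povm.
under eq_bigr do rewrite addbF.
move=> ->; rewrite state_dot_kron; last by case: (povm_obs_observable F_povm).
by rewrite expr0 mul1r; lra.
Qed.

Lemma guess_success_bob x : 2 * guess_success x - 1 <=
  state_dot keep_state (kron (povm_obs (cl_A S x)) 1%:M)
    (kron 1%:M (kron (povm_obs (cl_Bob S (Some x))) 1%:M)).
Proof.
case: S_valid => _ [_ [_ [Bob_povm Charlie_povm]]].
rewrite -(povm_obs_kronl _ (cl_Bob S (Some x))).
apply: guess_success_le_corr => [|a]; first exact: povm_kronl.
by rewrite -kronBr; apply: psdmx_kron (povm_le1 _ _) => //; case: (Bob_povm (Some x)).
Qed.

Lemma guess_success_charlie x : 2 * guess_success x - 1 <=
  state_dot keep_state (kron (povm_obs (cl_A S x)) 1%:M)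
    (kron 1%:M (kron 1%:M (povm_obs (cl_Charlie S (Some x))))).
Proof.
case: S_valid => _ [_ [_ [Bob_povm Charlie_povm]]].
rewrite -(povm_obs_kronr _ (cl_Charlie S (Some x))).
apply: guess_success_le_corr => [|a]; first exact: povm_kronr.
by rewrite -kronBl; apply: psdmx_kron (povm_le1 _ _) _ => //; case: (Charlie_povm (Some x)).
Qed.

Lemma guess_success_le1 x : guess_success x <= 1.
Proof.
case: S_valid => _ [A_povm [_ [Bob_povm Charlie_povm]]].
rewrite -(expectation1 keep_state_density) -kron1 -(expectation_kron_suml _ _ (A_povm x)).
apply: guess_success_le => a.
have -> : 1%:M - kron (cl_Bob S (Some x) a) (cl_Charlie S (Some x) a) =
    kron (1%:M - cl_Bob S (Some x) a) 1%:M +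
    kron (cl_Bob S (Some x) a) (1%:M - cl_Charlie S (Some x) a).
  by rewrite kronBl kronBr kron1 addrA subrK.
apply: psdmxD; apply: psdmx_kron; do ?exact: povm_le1; first exact: psdmx1.
by case: (Bob_povm (Some x)).
Qed.

Lemma keep_error_ge x : 1 - guess_success x <= 2 * keep_error.
Proof.
rewrite /keep_error big_bool /=.
by have := guess_success_le1 (~~ x); case: x => /=; lra.
Qed.

Lemma keep_error_ge0 : 0 <= keep_error.
Proof. by have := keep_error_ge true; have := guess_success_le1 true; lra. Qed.

Lemma keep_monogamy (A := alice_obs chsh_of_clone) :
  1 <= 4 * state_sqn (cl_rho S) (A true *m A true - 1%:M) +
    state_sqn (cl_rho S) (A false *m A true + A true *m A false) + 168 * keep_error.
Proof.
case: S_valid => _ [A_povm [_ [Bob_povm Charlie_povm]]].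
have [keep_psd tr_keep] := keep_state_density.
have := monogamy keep_psd tr_keep
  (observable_kronl _ (povm_obs_observable (A_povm false)))
  (observable_kronl _ (povm_obs_observable (A_povm true)))
  (observable_kronr _ (observable_kronl _ (povm_obs_observable (Bob_povm (Some false)))))
  (observable_kronr _ (observable_kronr _ (povm_obs_observable (Charlie_povm (Some true))))).
move=> /(_ (4 * keep_error)).
rewrite /A /alice_obs !mul_kron !mulmx1 -!kronDl -!kron_sub1l !state_sqn_keep.
have -> : 168 * keep_error = 42 * (4 * keep_error) by ring.
apply; [exact: comm_mx_kron | exact: comm_mx_kron | | |].
- by rewrite /comm_mx !mul_kron !mulmx1 !mul1mx.
- by apply: le_trans (guess_success_bob _); have := keep_error_ge false; lra.
- by apply: le_trans (guess_success_charlie _); have := keep_error_ge true; lra.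
Qed.

(* 1300 dominates both 12 * (4 + 104), where 12 >= 8 sqrt 2, and 168. *)
Lemma clone_tradeoff :
  1 <= 1300 * (tsirelson_value R - chsh_winprob chsh_of_clone + keep_error).
Proof.
have game_valid := chsh_of_clone_valid; have [[rho_psd tr_rho] _] := game_valid.
have A_obs := alice_obs_observable game_valid; have B_obs := bob_obs_observable game_valid.
have loss_ge0 : 0 <= tsirelson_value R - chsh_winprob chsh_of_clone.
  by rewrite subr_ge0 tsirelson_bound.
have defect_le : chsh_defect (cl_rho S) (alice_obs chsh_of_clone) (bob_obs chsh_of_clone) <=
    12 * (tsirelson_value R - chsh_winprob chsh_of_clone).
  rewrite (chsh_defectE game_valid) ler_wpM2r //.
  by have := sqr_sqrtr (ler0n R 2); have := sqrtr_ge0 (2 : R); nra.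
have := sqn_sqr_sub1_chsh rho_psd tr_rho A_obs B_obs true.
have := sqn_anticommutator_chsh rho_psd tr_rho A_obs B_obs (comm_bob_alice _ _).
by have /= := keep_monogamy; have := keep_error_ge0; lra.
Qed.

End CloneGame.

Definition clone_gap (R : realType) (g al : R) : R :=
  Num.min g ((1 - g) * (1 - al) ^+ 2) / 1300.

Lemma clone_gap_gt0 (R : realType) (g al : R) : 0 < g < 1 -> al < 1 -> 0 < clone_gap g al.
Proof.
move=> /andP[g_gt0 g_lt1] al_lt1; rewrite divr_gt0 // lt_min g_gt0.
by rewrite mulr_gt0 ?exprn_gt0 ?subr_gt0.
Qed.

Lemma clone_winprob_le (R : realType) (g al : R) dA dB dBo dCh nK
    (S : clone_strategy R dA dB dBo dCh nK) :
  0 <= g <= 1 -> clone_valid S ->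
  clone_winprob g al S <= (1 - g) + g * tsirelson_value R - clone_gap g al.
Proof.
move=> /andP[g_ge0 g_le1] S_valid; rewrite (clone_winprobE S_valid) /clone_gap.
set c := (1 - g) * (1 - al) ^+ 2; set m := Num.min g c.
have := clone_tradeoff S_valid.
have := keep_error_ge0 S_valid; have := tsirelson_bound (chsh_of_clone_valid S_valid).
move: (keep_error S) (chsh_winprob _) (tsirelson_value R) => e w t w_le e_ge0 tradeoff.
have m_ge0 : 0 <= m by rewrite le_min g_ge0 mulr_ge0 ?subr_ge0 ?sqr_ge0.
have loss_ge : m / 1300 <= g * (t - w) + c * e.
  apply: (@le_trans _ _ (m * (t - w) + m * e)).
    by rewrite -mulrDr ler_wpM2l //; lra.
  by apply: lerD; rewrite ler_wpM2r ?subr_ge0 // ge_min lexx ?orbT.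
rewrite mulrBr mulr1 mulrA -/c.
by lra.
Qed.

Lemma clone_bound_ge0 (R : realType) (g al : R) : 0 <= g <= 1 ->
  0 <= (1 - g) + g * tsirelson_value R - clone_gap g al.
Proof.
move=> /andP[g_ge0 g_le1].
have gap_le : clone_gap g al <= g / 1300.
  by rewrite ler_pM2r ?invr_gt0 ?ltr0n // ge_min lexx.
have value_ge : g * (1 / 2) <= g * tsirelson_value R.
  by rewrite ler_wpM2l // lerDl divr_ge0 ?sqrtr_ge0.
by lra.
Qed.

Theorem theorem18 (R : realType) (gamma alpha : R) :
  0 < gamma < 1 -> 0 < alpha < 1 ->
  exists delta : R, 0 < delta /\
    clone_qvalue gamma alpha <= (1 - gamma) + gamma * chsh_qvalue R - delta.
Proof.
move=> gamma01 /andP[_ alpha_lt1]; exists (clone_gap gamma alpha).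
split; first exact: clone_gap_gt0.
have gamma_itv : 0 <= gamma <= 1 by case/andP: gamma01 => /ltW-> /ltW->.
rewrite chsh_qvalueE; apply: sup_le_nneg; first exact: clone_bound_ge0.
by move=> _ [dA [dB [dBo [dCh [nK [S [S_valid ->]]]]]]]; apply: clone_winprob_le.
Qed.
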